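(* For every list $Q$ of sequences (as in the context), let $G_Q=(V,A)$ be its sequence graph with $V=\{v_1,\ldots,v_m\}$. Consider the following integer linear program. Variables: binary $x_i^j$ for $i,j\in[m]$; an integer variable $w$; binary $X(i,i',j,j')$ for $i,i',j,j'\in[m]$; binary $Y(j,c)$ for $j,c\in[m-1]$ with $j\le c$. Minimize $w$ subject to: (1) $\sum_{j=1}^m x_i^j=1$ for every $i\in[m]$, and $\sum_{i=1}^m x_i^j=1$ for every $j\in[m]$; (2) $\sum_{j=1}^{c} Y(j,c)\le w$ for every $c\in[m-1]$; (3) $X(i,i',j,j')-x_i^j\le 0$, $X(i,i',j,j')-x_{i'}^{j'}\le 0$, and $x_i^j+x_{i'}^{j'}-X(i,i',j,j')\le 1$ for all $i,i',j,j'\in[m]$; (4) $X(i,i',j,j')-Y(j,c)\le 0$ for all $j,c\in[m-1]$ with $j\le c$, all $j'\in\{c+1,\ldots,m\}$ and all $i,i'\in[m]$ with $(v_{i'},v_i)\in A$; and $\sum_{j'\in\{c+1,\ldots,m\},\ i,i'\in[m],\ (v_{i'},v_i)\in A} X(i,i',j,j') - Y(j,c)\ge 0$ for all $j,c\in[m-1]$ with $j\le c$. Then $p=w+1$, where $w$ is the optimal objective value, is the minimum number such that there is a processing of $Q$ in which in each configuration at most $p$ pallets are open.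
   Context: FIFO Stack-Up problem. An instance consists of a list $Q=(q_1,\ldots,q_k)$ of sequences of pairwise distinct bins, each bin $b$ having a pallet symbol ${\it plt}(b)$; the distinct pallet symbols (pallets) number $m$. Standing assumption: every pallet is carried by at least two bins. A configuration is a tuple $(i_1,\ldots,i_k)$ with $0\le i_j\le |q_j|$, meaning that the first $i_j$ bins of $q_j$ have been removed. A pallet $t$ is open in configuration $(i_1,\ldots,i_k)$ if there are indices $j,\ell$ such that some bin for $t$ is at a position $\le i_j$ in $q_j$ and some bin for $t$ is at a position $> i_\ell$ in $q_\ell$. A transformation step removes the bin at position $i_j+1$ of some sequence $q_j$ (with $i_j<|q_j|$). A processing of $Q$ is a sequence of transformation steps from $(0,\ldots,0)$ to $(|q_1|,\ldots,|q_k|)$. The sequence graph $G_Q=(V,A)$ has as vertex set the set of pallets, and an arc $(u,v)$ if and only if $u\neq v$ and there is a sequence $q_\ell$ containing a bin for $u$ at some position strictly before a bin for $v$. $[m]=\{1,\ldots,m\}$. *)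

(* Defs.v *)
From HB Require Import structures.
From mathcomp Require Import all_boot all_order all_algebra.

Set Implicit Arguments.
Unset Strict Implicit.
Unset Printing Implicit Defensive.

(* All index ranges are 0-based: [m] is 'I_m, and the
   configuration entry i_j is the number of bins already removed from q_j. *)

Section FifoStackUp.

Variables (T B : eqType) (plt : B -> T) (k : nat) (Q : k.-tuple (seq B)).

Definition pallets : seq T := undup (map plt (flatten Q)).

(* The bins are pairwise distinct over the whole list, not only within each
   sequence, so counting occurrences in [flatten Q] counts bins. *)
Definition instance : Prop :=
  uniq (flatten Q) /\
  {in pallets, forall t, 1 < count (fun b => plt b == t) (flatten Q)}.

Definition config := {ffun 'I_k -> nat}.

Definition is_open (c : config) (t : T) : bool :=
  [exists j, has (fun b => plt b == t) (take (c j) (tnth Q j))] &&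
  [exists l, has (fun b => plt b == t) (drop (c l) (tnth Q l))].

Definition num_open (c : config) : nat := count (is_open c) pallets.

Definition step (c c' : config) : bool :=
  [exists j, (c j < size (tnth Q j)) &&
             (c' == [ffun l => if l == j then (c l).+1 else c l])].

Definition start : config := [ffun _ => 0].
Definition finish : config := [ffun j => size (tnth Q j)].

(* [s] lists the configurations reached after each transformation step. *)
Definition processing (s : seq config) : Prop :=
  path step start s /\ last start s = finish.

Definition processable (p : nat) : Prop :=
  exists2 s, processing s & all (fun c => num_open c <= p) (start :: s).

Definition min_processable (p : nat) : Prop :=
  processable p /\ forall p', processable p' -> p <= p'.

Definition seq_arc (u v : T) : bool :=
  (u != v) &&
  [exists l : 'I_k,
    [exists a : 'I_(size (tnth Q l)), [exists b : 'I_(size (tnth Q l)),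
      [&& a < b, plt (tnth (in_tuple (tnth Q l)) a) == u
               & plt (tnth (in_tuple (tnth Q l)) b) == v]]]].

End FifoStackUp.

Import Order.TTheory GRing.Theory Num.Theory.
Local Open Scope ring_scope.

(* [lp_x i j] is x_i^j (v_i is placed at position j). Only the entries [lp_Y j c]
   with j <= c are variables of the program; the others are unconstrained and
   occur nowhere in it. *)
Record lp_assignment (m : nat) := LpAssignment {
  lp_x : 'I_m -> 'I_m -> int;
  lp_w : int;
  lp_X : 'I_m -> 'I_m -> 'I_m -> 'I_m -> int;
  lp_Y : 'I_m.-1 -> 'I_m.-1 -> int
}.

Definition binary (z : int) : Prop := z = 0 \/ z = 1.

Definition pos_of m (j : 'I_m.-1) : 'I_m := widen_ord (leq_pred m) j.

Section Program.

(* [A i i'] means (v_i, v_i') is an arc. *)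
Variables (m : nat) (A : rel 'I_m) (s : lp_assignment m).

Let x := lp_x s.
Let w := lp_w s.
Let X := lp_X s.
Let Y := lp_Y s.

Definition lp_domain : Prop :=
  [/\ forall i j, binary (x i j),
      forall i i' j j', binary (X i i' j j')
    & forall j c : 'I_m.-1, (j <= c)%N -> binary (Y j c)].

Definition lp_constr1 : Prop :=
  (forall i, \sum_(j < m) x i j = 1) /\ (forall j, \sum_(i < m) x i j = 1).

Definition lp_constr2 : Prop :=
  forall c : 'I_m.-1, \sum_(j < m.-1 | (j <= c)%N) Y j c <= w.

Definition lp_constr3 : Prop :=
  forall i i' j j',
    [/\ X i i' j j' - x i j <= 0,
        X i i' j j' - x i' j' <= 0
      & x i j + x i' j' - X i i' j j' <= 1].

Definition lp_constr4 : Prop :=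
  (forall (j c : 'I_m.-1) (j' i i' : 'I_m),
     (j <= c)%N -> (c < j')%N -> A i' i ->
     X i i' (pos_of j) j' - Y j c <= 0) /\
  (forall j c : 'I_m.-1, (j <= c)%N ->
     0 <= (\sum_(j' < m | (c < j')%N) \sum_(i < m) \sum_(i' < m | A i' i)
             X i i' (pos_of j) j') - Y j c).

Definition lp_feasible : Prop :=
  [/\ lp_domain, lp_constr1, lp_constr2, lp_constr3 & lp_constr4].

End Program.

(* For m <= 1 the second constraint family is empty, so lp_w is unbounded below
   and no optimal assignment exists; for m >= 2 it forces 0 <= lp_w. *)
Definition lp_optimal m (A : rel 'I_m) (s : lp_assignment m) : Prop :=
  lp_feasible A s /\ forall s', lp_feasible A s' -> lp_w s <= lp_w s'.

(* Main.v *)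
(** The program encodes linear layouts of the sequence graph: [x] is a
    permutation sigma of the pallets, [X] holds the products of entries of [x],
    and [Y j c] is forced to 1 exactly when the pallet at position [j <= c] has
    an in-neighbour placed after [c]. So the optimum is the least directed vertex
    separation number of a layout, and it remains to see that a processing with
    at most [p] open pallets exists iff some layout has separation below [p].

    Given a processing, order the pallets by opening time. When a pallet opens,
    each pallet of the cut just before it is already open, and it still has a
    bin waiting behind a bin of a pallet that was unopened one step earlier.
    Conversely, given a layout, remove for c = 1, 2, ... all bins that can be
    reached by removing only bins of the first c pallets. In stage c an open
    pallet other than the c-th one has a bin blocked by a later pallet, hence
    belongs to the cut. *)

Require Import Defs.
From HB Require Import structures.
From mathcomp Require Import all_boot all_order all_algebra.
From mathcomp Require Import all_fingroup zify.

Set Implicit Arguments.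
Unset Strict Implicit.
Unset Printing Implicit Defensive.

Import Order.TTheory GRing.Theory Num.Theory.

(** * Vertex separation of layouts *)

Section Separation.

Variables (m : nat) (A : rel 'I_m).

Definition cut (sigma : 'S_m) (c : nat) : {set 'I_m} :=
  [set i | (sigma i < c) && [exists i', (c <= sigma i') && A i' i]].

(** The cuts at [0] and at [m] are empty, so the indices strictly between them decide the maximum;
    these match the constraints on [c] in the program. *)
Definition separation (sigma : 'S_m) : nat := \max_(c < m) #|cut sigma c|.

Lemma cut_separation sigma c : c < m -> #|cut sigma c| <= separation sigma.
Proof.
by move=> cm; apply: (leq_bigmax (Ordinal cm)).
Qed.

Lemma cut0 sigma : cut sigma 0 = set0.
Proof. by apply/setP=> i; rewrite !inE. Qed.

End Separation.

Section Counting.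

Variables (T : eqType) (m : nat) (v : m.-tuple T).

Lemma count_tuple (p : pred T) : count p v = #|[set i | p (tnth v i)]|.
Proof.
rewrite -sum1_count -sum1_card big_tuple.
by apply: eq_bigl => i; rewrite !inE.
Qed.

End Counting.

(** Each index is sent to the number of indices with a smaller value. This turns opening times into
    a layout. *)
Lemma rank_perm (m : nat) (a : 'I_m -> nat) : injective a ->
  exists sigma : 'S_m, forall i j, (sigma i < sigma j) = (a i < a j).
Proof.
move=> a_inj; pose below i := [set j | a j < a i].
have below_lt i : #|below i| < m.
  rewrite -[ltnRHS]card_ord -cardsT; apply: proper_card.
  by apply/properP; split; [exact: subsetT | exists i; rewrite !inE ?ltnn].
have belowE i j : (#|below i| < #|below j|) = (a i < a j).
  case: ltnP => [lt_ij|le_ji]; last first.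
    case: ltnP => // aij; suff: #|below i| < #|below j| by rewrite ltnNge le_ji.
    apply: proper_card; apply/properP; split.
      by apply/subsetP=> l; rewrite !inE => /ltn_trans->.
    by exists i; rewrite !inE ?ltnn.
  symmetry; rewrite ltnNge; apply/negP=> aji; move: lt_ij; rewrite ltnNge => /negP[].
  by apply/subset_leq_card/subsetP=> l; rewrite !inE => /leq_trans->.
have rank_inj : injective (fun i => Ordinal (below_lt i)).
  move=> i j /(congr1 val) /= eq_ij; apply: a_inj; apply/eqP.
  rewrite eqn_leq (leqNgt (a i)) (leqNgt (a j)).
  by rewrite -!belowE eq_ij ltnn.
by exists (perm rank_inj) => i j; rewrite !permE /= belowE.
Qed.

(** * Counting removed bins along a processing *)

Section Processing.

Variables (T B : eqType) (plt : B -> T) (k : nat) (Q : k.-tuple (seq B)).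

Local Notation bins q t := (count (fun b => plt b == t) q).

(** Both halves of openness become bounds on this single number, and a step raises it by one for
    exactly one pallet. *)
Definition removed (e : config k) (t : T) : nat :=
  \sum_j bins (take (e j) (tnth Q j)) t.

Lemma count_flatten_tuple t : bins (flatten Q) t = \sum_j bins (tnth Q j) t.
Proof.
by rewrite count_flatten sumnE big_map big_tuple.
Qed.

Lemma removed_gt0 e t :
  (0 < removed e t) = [exists j, has (fun b => plt b == t) (take (e j) (tnth Q j))].
Proof.
rewrite lt0n sum_nat_eq0 negb_forall; apply: eq_existsb => j /=.
by rewrite has_count lt0n.
Qed.

Lemma removed_lt e t :
  (removed e t < bins (flatten Q) t) =
  [exists l, has (fun b => plt b == t) (drop (e l) (tnth Q l))].
Proof.
have -> : bins (flatten Q) t = removed e t + \sum_l bins (drop (e l) (tnth Q l)) t.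
  rewrite count_flatten_tuple -big_split; apply: eq_bigr => j _ /=.
  by rewrite -count_cat cat_take_drop.
rewrite -[ltnLHS]addn0 ltn_add2l lt0n sum_nat_eq0 negb_forall.
by apply: eq_existsb => j /=; rewrite has_count lt0n.
Qed.

Lemma is_openE e t : is_open plt Q e t = (0 < removed e t < bins (flatten Q) t).
Proof. by rewrite removed_gt0 removed_lt. Qed.

Lemma removed_start t : removed (start k) t = 0.
Proof. by rewrite /removed big1 // => j _; rewrite ffunE take0. Qed.

Lemma removed_finish t : removed (finish Q) t = bins (flatten Q) t.
Proof.
rewrite count_flatten_tuple; apply: eq_bigr => j _.
by rewrite ffunE take_size.
Qed.

Lemma removed_step e e' : step Q e e' ->
  exists t0, forall t, removed e' t = removed e t + (t0 == t).
Proof.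
case/existsP=> j /andP[ltj /eqP->].
case Ej: (tnth Q j) => [|b0 q]; first by rewrite Ej in ltj.
exists (plt (nth b0 (tnth Q j) (e j))) => t.
rewrite /removed (bigD1 j) //= [in RHS](bigD1 j) //= ffunE eqxx.
rewrite (take_nth b0) // -cats1 count_cat /= addn0 addnAC; congr (_ + _ + _).
by apply: eq_bigr => l /negPf nlj; rewrite ffunE nlj.
Qed.

(** A cut point [n] replaces the two positions, which suits configurations since they cut every
    sequence in two. *)
Lemma seq_arcP u t :
  reflect (u != t /\ exists (l : 'I_k) n,
             has (fun b => plt b == u) (take n (tnth Q l)) /\
             has (fun b => plt b == t) (drop n (tnth Q l)))
          (seq_arc plt Q u t).
Proof.
apply: (iffP andP) => -[ut H]; split=> //.
  case/existsP: H => l /existsP[a /existsP[b /and3P[ab au bt]]].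
  exists l, b; have b0 := tnth (in_tuple (tnth Q l)) a.
  rewrite !(tnth_nth b0) /= in au bt; split.
    apply/hasP; exists (nth b0 (tnth Q l) a) => //.
    by rewrite -(nth_take b0 ab) mem_nth // size_take ltn_ord.
  apply/hasP; exists (nth b0 (tnth Q l) b) => //.
  by rewrite (drop_nth b0) // mem_head.
case: H => l [n [H1 H2]].
case Ej: (tnth Q l) => [|b0 q]; first by rewrite Ej in H1.
case/(has_nthP b0): H1 => a; rewrite size_take_min leq_min => /andP[an aq].
rewrite nth_take // => au.
case/(has_nthP b0): H2 => b; rewrite size_drop ltn_subRL nth_drop => bq bt.
apply/existsP; exists l; apply/existsP; exists (Ordinal aq).
apply/existsP; exists (Ordinal bq).
by rewrite !(tnth_nth b0) /= au bt ltn_addr.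
Qed.

(** As no bin of [u] is gone, [e] cuts the sequence of the arc at or before [n], and the bin for [t]
    behind [n] still waits. *)
Lemma arc_removed_lt e u t : seq_arc plt Q u t -> removed e u = 0 ->
  removed e t < bins (flatten Q) t.
Proof.
case/seq_arcP=> _ [l [n [Hu Ht]]] e0; rewrite removed_lt; apply/existsP; exists l.
have: ~~ (0 < removed e u) by rewrite e0.
rewrite removed_gt0 negb_exists => /forallP/(_ l) /= Hn.
have en : e l <= n.
  rewrite leqNgt; apply/negP=> /ltnW ne; case/negP: Hn.
  move: Hu; rewrite -(take_takel _ ne) => Hu.
  by rewrite -(cat_take_drop n (take _ _)) has_cat Hu.
by move: Ht; rewrite -(subnK en) -drop_drop => Ht;
  rewrite -(cat_take_drop (n - e l) (drop (e l) _)) has_cat Ht orbT.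
Qed.

(** Induction on the number of bins still to remove. The last clause lets a bound valid for all
    configurations between [e] and [f] apply to the whole path. *)
Lemma config_path (e f : config k) :
  (forall l, e l <= f l <= size (tnth Q l)) ->
  exists s, [/\ path (step Q) e s, last e s = f
    & {in e :: s, forall (g : config k) l, e l <= g l <= f l}].
Proof.
move En: (\sum_l (f l - e l)) => n; elim: n e En => [|n IH] e En le_ef.
  have eqef : e = f.
    apply/ffunP=> l; apply/eqP; rewrite eqn_leq; case/andP: (le_ef l) => -> _ /=.
    by move/eqP: En; rewrite sum_nat_eq0 => /forallP/(_ l)/=; rewrite subn_eq0.
  exists [::]; split=> // g; rewrite inE => /eqP-> l.
  by rewrite leqnn -eqef /=.
have [l lt_l] : exists l, e l < f l.
  have: (0 < \sum_l (f l - e l)) by rewrite En.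
  rewrite lt0n sum_nat_eq0 negb_forall => /existsP[l /= H]; exists l.
  by rewrite -subn_gt0 lt0n.
pose e' : config k := [ffun i => if i == l then (e i).+1 else e i].
have e'l i : e' i = e i + (i == l) by rewrite ffunE; case: eqP; lia.
case: (IH e') => [|i|s [ps ls inb]].
- move: En; rewrite (bigD1 l) //= [in X in _ -> X](bigD1 l) //= e'l eqxx.
  under [in X in _ -> X]eq_bigr => i /negPf il do rewrite e'l il addn0.
  lia.
- by move: (le_ef i); rewrite e'l; case: eqP => [->|_]; lia.
exists (e' :: s); split=> //=.
  rewrite ps andbT; apply/existsP; exists l; apply/andP; split=> //.
  by case/andP: (le_ef l) => _; apply: leq_trans.
move=> g; rewrite inE => /orP[/eqP->|/inb H] i.
  by move: (le_ef i); lia.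
by move: (H i); rewrite e'l; lia.
Qed.

(** * From a layout to a processing *)

Variables (m : nat) (v : m.-tuple T).
Hypothesis hv : perm_eq v (pallets plt Q).

Let A : rel 'I_m := fun i i' => seq_arc plt Q (tnth v i) (tnth v i').

Lemma num_openE e : num_open plt Q e = #|[set i | is_open plt Q e (tnth v i)]|.
Proof. by rewrite -count_tuple; apply/seq.permP; rewrite perm_sym. Qed.

Lemma uniq_v : uniq v.
Proof. by rewrite (perm_uniq hv) undup_uniq. Qed.

Lemma tnth_v_inj : injective (tnth v).
Proof. by apply/tuple_uniqP/uniq_v. Qed.

Lemma plt_tnth l b : b \in tnth Q l -> exists i, plt b = tnth v i.
Proof.
move=> bQ; apply/tnthP; rewrite (perm_mem hv) mem_undup map_f //.
by apply/flattenP; exists (tnth Q l); rewrite ?mem_tnth.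
Qed.

(* The furthest configuration reachable by removing only bins of the pallets
   placed at positions below [c]. *)
Definition greedy (sigma : 'S_m) (c : nat) : config k :=
  [ffun l => find (fun b => [exists i, (c <= sigma i) && (tnth v i == plt b)])
                  (tnth Q l)].

Lemma greedy0 sigma : greedy sigma 0 = start k.
Proof.
apply/ffunP=> l; rewrite !ffunE; case E: (tnth Q l) => [|b q] //=.
have [|i bi] := @plt_tnth l b; first by rewrite E mem_head.
by rewrite ifT //; apply/existsP; exists i; rewrite bi eqxx.
Qed.

Lemma greedy_finish sigma : greedy sigma m = finish Q.
Proof.
apply/ffunP=> l; rewrite !ffunE; apply: hasNfind; apply/hasPn=> b _.
by apply/existsPn=> i; rewrite leqNgt ltn_ord.
Qed.

Lemma greedyS sigma c l : greedy sigma c l <= greedy sigma c.+1 l.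
Proof.
rewrite !ffunE; apply: sub_find => b /existsP[i /andP[ci bi]].
by apply/existsP; exists i; rewrite ltnW.
Qed.

Lemma greedy_size sigma c l : greedy sigma c l <= size (tnth Q l).
Proof. by rewrite ffunE find_size. Qed.

Lemma greedy_open sigma c (e : config k) : c < m ->
  (forall l, greedy sigma c l <= e l <= greedy sigma c.+1 l) ->
  num_open plt Q e <= (separation A sigma).+1.
Proof.
move=> cm le_e.
(* The pallet at position [c] accounts for the extra one in the bound. *)
have sub : [set i | is_open plt Q e (tnth v i)] \subset
           (sigma^-1%g (Ordinal cm)) |: cut A sigma c.
  apply/subsetP=> i; rewrite !inE => /andP[/existsP[l Hl] /existsP[l' Hl']].
  have sic : sigma i <= c.
    rewrite leqNgt; apply/negP=> ci; case/hasP: Hl => b btake bi.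
    have /andP[_ le_el] := le_e l.
    case/(nthP b): btake => n; rewrite size_take_min leq_min => /andP[ne nq].
    rewrite nth_take // => nb.
    have := leq_trans ne le_el; rewrite ffunE => /(before_find b)/negbT/negP[].
    by apply/existsP; exists i; rewrite nb ci eq_sym bi.
  case: (ltngtP (sigma i) c) sic => // [sic _|sic _]; last first.
    suff -> : i = sigma^-1%g (Ordinal cm) by rewrite eqxx.
    by apply: (@perm_inj _ sigma); rewrite permKV; apply: val_inj.
  apply/orP; right => /=.
  have /andP[+ _] := le_e l'; move=> le_el.
  have Hl2 : has (fun b => plt b == tnth v i) (drop (greedy sigma c l') (tnth Q l')).
    move: Hl'; rewrite -(subnK le_el) -drop_drop.
    move: (drop (greedy _ _ _) _) => q H.
    by rewrite -(cat_take_drop (e l' - greedy sigma c l') q) has_cat H orbT.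
  have ltD : greedy sigma c l' < size (tnth Q l').
    by rewrite ltnNge; apply/negP=> /drop_oversize E; rewrite E in Hl2.
  case Ej: (tnth Q l') => [|b0 q]; first by rewrite Ej in ltD.
  (* The bin at which [greedy sigma c] stops belongs to a pallet [i'] placed at [c] or later; the
     waiting bin of [i] lies behind it. *)
  have := ltD; rewrite {1}ffunE -has_find => /(nth_find b0) /existsP[i' /andP[ci' bi']].
  have ii' : tnth v i' != tnth v i.
    by apply: contraTneq ci' => /tnth_v_inj ->; rewrite -ltnNge.
  apply/existsP; exists i'; rewrite ci' /=; apply/seq_arcP; split=> //.
  have bi : plt (nth b0 (tnth Q l') (greedy sigma c l')) = tnth v i'.
    by rewrite (eqP bi') ffunE.
  (* Cutting just past the blocking bin keeps the bin of [i] on the right, since the two pallets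
     differ. *)
  exists l', (greedy sigma c l').+1; split.
    by rewrite (take_nth b0) // has_rcons bi eqxx.
  by move: Hl2; rewrite (drop_nth b0) //= bi (negPf ii').
rewrite num_openE; apply: (leq_trans (subset_leq_card sub)).
rewrite cardsU1 -add1n leq_add ?cut_separation //.
by case: (_ \notin _).
Qed.

Lemma processable_separation sigma :
  processable plt Q (separation A sigma).+1.
Proof.
pose small e := num_open plt Q e <= (separation A sigma).+1.
have small0 : small (start k).
  rewrite /small num_openE (_ : [set _ | _] = set0) ?cards0 //.
  by apply/setP=> i; rewrite !inE is_openE removed_start.
suff [s [ps ls als]] : exists s, [/\ path (step Q) (start k) s,
    last (start k) s = greedy sigma m & all small (start k :: s)].
  by exists s => //; split=> //; rewrite ls greedy_finish.
(* Only the number of completed stages is generalised, so that the stages can be concatenated one by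
   one. *)
have: m <= m by []; move: {1 3}m => n; elim: n => [_|n IH nm].
  by exists [::]; rewrite greedy0 /= small0.
have [s [ps ls als]] := IH (ltnW nm).
have [|s' [ps' ls' als']] := @config_path (greedy sigma n) (greedy sigma n.+1).
  by move=> l; rewrite greedyS greedy_size.
exists (s ++ s'); split.
- by rewrite cat_path ps ls.
- by rewrite last_cat ls.
rewrite -cat_cons all_cat als; apply/allP=> g gs'.
by apply: (greedy_open nm) => l; apply: als'; rewrite inE gs' orbT.
Qed.

(** * From a processing to a layout *)

Hypothesis hQ : instance plt Q.

Lemma count_v_gt1 i : 1 < bins (flatten Q) (tnth v i).
Proof. by case: hQ => _; apply; rewrite -(perm_mem hv) mem_tnth. Qed.

Lemma separation_processable p : 0 < m -> processable plt Q p ->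
  exists sigma, separation A sigma < p.
Proof.
move=> m0 [s [ps ls] /allP als].
pose e n := nth (start k) (start k :: s) n.
pose a i := find (fun g => 0 < removed g (tnth v i)) (start k :: s).
have removed_mono t n n' : n <= n' <= size s -> removed (e n) t <= removed (e n') t.
  pose le_t g g' := removed g t <= removed g' t.
  have srt : sorted le_t (start k :: s).
    apply: sub_path ps => g g' /removed_step[t0 E]; rewrite /le_t E; exact: leq_addr.
  case/andP=> nn' n's; apply: (sorted_leq_nth _ _ (start k) srt) => //.
  - by move=> x y z; apply: leq_trans.
  - by move=> x; apply: leqnn.
  - by rewrite inE /= ltnS (leq_trans nn').
have a_has i : has (fun g => 0 < removed g (tnth v i)) (start k :: s).
  apply/hasP; exists (finish Q); first by rewrite -ls mem_last.
  by rewrite removed_finish (ltn_trans _ (count_v_gt1 i)).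
have a_size i : a i <= size s by have := a_has i; rewrite has_find ltnS.
have a_gt0 i : 0 < removed (e (a i)) (tnth v i).
  by apply: (nth_find (start k) (a_has i)).
have a_lt i n : n < a i -> removed (e n) (tnth v i) = 0.
  by move/(before_find (start k))/negbT; rewrite -eqn0Ngt => /eqP.
have a_pos i : 0 < a i by rewrite /a /= removed_start.
(* The step that opens a pallet removes one of its own bins; hence no two pallets open at the same
   time. *)
have a_step i t : removed (e (a i)) t = removed (e (a i).-1) t + (tnth v i == t).
  have /removed_step[t0 E] : step Q (e (a i).-1) (e (a i)).
    move/(pathP (start k))/(_ (a i).-1): ps; rewrite prednK // => /(_ (a_size i)).
    by rewrite /e; case: (a i) (a_pos i).
  suff -> : tnth v i = t0 by [].
  have := a_gt0 i; rewrite E a_lt ?prednK //.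
  by case: eqP.
have a_inj : injective a.
  move=> i j aij; apply: tnth_v_inj; apply/eqP.
  have := a_gt0 j; rewrite -aij a_step a_lt ?aij ?prednK //.
  by case: eqP.
have [sigma sigmaE] := rank_perm a_inj; exists sigma.
suff lt_cut (c : 'I_m) : #|cut A sigma c| < p.
  rewrite /separation; have p0 := leq_ltn_trans (leq0n _) (lt_cut (Ordinal m0)).
  by rewrite -(prednK p0) ltnS; apply/bigmax_leqP=> c _; rewrite -ltnS prednK.
pose i0 := sigma^-1%g c; have si0 : sigma i0 = c by rewrite permKV.
(* Since [i0] lies outside the cut, the inclusion yields the strict inequality. At its opening time
   [i0] has lost exactly one of its at least two bins, so it is open. *)
have sub : i0 |: cut A sigma c \subset [set i | is_open plt Q (e (a i0)) (tnth v i)].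
  apply/subsetP=> i; rewrite !inE is_openE => /orP[/eqP->|].
    by rewrite a_gt0 a_step a_lt ?prednK // eqxx count_v_gt1.
  case/andP; rewrite -si0 sigmaE => ai /existsP[i' /andP[]].
  rewrite leqNgt sigmaE -leqNgt => ai' arc.
  have ne : (tnth v i0 == tnth v i) = false.
    by apply/eqP=> /tnth_v_inj E; rewrite E ltnn in ai.
  (* The count for [i] is the same one configuration earlier, where the in-neighbour [i'] is surely
     untouched; [i'] may be [i0] itself. *)
  rewrite a_step ne addn0; apply/andP; split.
    apply: (leq_trans (a_gt0 i)); apply: removed_mono.
    by move: (a_size i0); lia.
  by apply: (arc_removed_lt arc); apply: a_lt; rewrite (leq_trans _ ai') ?prednK.
have i0cut : i0 \notin cut A sigma c by rewrite !inE si0 ltnn.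
have := subset_leq_card sub; rewrite cardsU1 i0cut -num_openE => /leq_trans; apply.
by apply: als; apply: mem_nth; rewrite /= ltnS.
Qed.

End Processing.

Local Open Scope ring_scope.

Lemma pos_of_inj m : injective (@pos_of m).
Proof. by move=> j j' /(congr1 val) E; apply: val_inj. Qed.

(** * Layouts as feasible assignments *)

Section LinearProgram.

Variables (m : nat) (A : rel 'I_m).

Lemma binary_ge0 z : binary z -> 0 <= z.
Proof. by case=> ->. Qed.

Lemma binary_sum1_unique (I : finType) (f : I -> int) :
  (forall i, binary (f i)) -> \sum_i f i = 1 ->
  exists i, f i = 1 /\ forall j, f j = 1 -> j = i.
Proof.
move=> fb f1.
have [i fi] : exists i, f i = 1.
  case: (pickP (fun i => f i == 1)) => [i /eqP|f0]; first by exists i.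
  move: f1; rewrite big1 // => i _; case: (fb i) => // fi.
  by have := f0 i; rewrite fi.
exists i; split=> // j fj; apply/eqP/negPn/negP=> ji.
move: f1; rewrite (bigD1 i) //= (bigD1 j) //= fi fj.
have : 0 <= \sum_(l | (l != i) && (l != j)) f l.
  by apply: sumr_ge0 => l _; apply: binary_ge0.
move: (\sum_(l | _) f l) => S S0 E.
lia.
Qed.

(** Constraint (1) makes [lp_x] a permutation matrix, (3) and (4) force [lp_Y] to 1 on each cut, and
    (2) then bounds the size of the cut by [lp_w]. *)
Lemma feasible_separation s : (1 < m)%N -> lp_feasible A s ->
  exists sigma, (separation A sigma)%:Z <= lp_w s.
Proof.
move=> m1 [[xb Xb Yb] [c1 c1'] c2 c3 [c4 _]].
have rowP i := binary_sum1_unique (xb i) (c1 i).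
pose f i := odflt i [pick j | lp_x s i j == 1].
have xf i : lp_x s i (f i) = 1.
  rewrite /f; case: pickP => [j /eqP//|H] /=.
  by case: (rowP i) => j [xj _]; have := H j; rewrite xj.
have f_inj : injective f.
  move=> i i' fii'.
  have [i0 [_ H]] := binary_sum1_unique (fun l => xb l (f i)) (c1' (f i)).
  have i'E : i' = i0 by apply: H; rewrite fii' xf.
  by rewrite i'E; apply/H/xf.
pose sigma := perm f_inj; exists sigma.
have sigmaE i : sigma i = f i by rewrite permE.
have w_ge0 : 0 <= lp_w s.
  have m2 : (0 < m.-1)%N by rewrite -ltnS prednK // ltnW.
  apply: le_trans (c2 (Ordinal m2)); apply: sumr_ge0 => j jc.
  by apply/binary_ge0/Yb.
have lt_cut c : (c < m)%N -> (#|cut A sigma c|)%:Z <= lp_w s.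
  case: c => [_|c cm]; first by rewrite cut0 cards0.
  have cm1 : (c < m.-1)%N by lia.
  apply: le_trans (c2 (Ordinal cm1)).
  (* The positions occupied by the cut are all at most [c], so they fit into the smaller index type
     of [lp_Y]. *)
  pose J := [set j : 'I_m.-1 | pos_of j \in sigma @: cut A sigma c.+1].
  have JE : #|cut A sigma c.+1| = #|J|.
    rewrite -(card_imset _ (@perm_inj _ sigma)).
    rewrite -(card_imset _ (@pos_of_inj m)); apply: eq_card => j.
    apply/idP/imsetP => [jc|[j' + ->]]; last by rewrite inE.
    have jm : (j < m.-1)%N.
      by case/imsetP: jc => i; rewrite inE => /andP[ic _] ->; apply: leq_ltn_trans cm1.
    have E : j = pos_of (Ordinal jm) by apply: val_inj.
    by exists (Ordinal jm); rewrite // inE -E.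
  have JP j : j \in J -> (j <= c)%N /\ 1 <= lp_Y s j (Ordinal cm1).
    rewrite inE => /imsetP[i]; rewrite inE => /andP[ic /existsP[i' /andP[ci' Aii']]] E.
    have jc : (j <= c)%N by move: ic; rewrite -E.
    split=> //; have := c4 j (Ordinal cm1) (sigma i') i i' jc ci' Aii'.
    have [_ _] := c3 i i' (sigma i) (sigma i').
    by rewrite E !sigmaE !xf; lia.
  rewrite JE -sum1_card -natz natr_sum (big_mkcond (fun j => j \in J)).
  rewrite [in leRHS]big_mkcond /=; apply: ler_sum => j _.
  case: ifP => [/JP[-> //]|_]; case: ifP => // jc.
  by apply/binary_ge0/Yb.
rewrite /separation; elim/big_ind: _ => // [x y|c _]; last exact: lt_cut.
by rewrite /maxn; case: ifP.
Qed.

(** With positions counted from 0, constraint index [c] separates positions up to [c] from later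
    ones, hence the cut at [c.+1]. *)
Definition layout_assignment (sigma : 'S_m) : lp_assignment m :=
  {| lp_x := fun i j => (sigma i == j)%:R;
     lp_w := (separation A sigma)%:Z;
     lp_X := fun i i' j j' => ((sigma i == j) && (sigma i' == j'))%:R;
     lp_Y := fun j c => (pos_of j \in sigma @: cut A sigma c.+1)%:R |}.

Lemma binaryb (b : bool) : binary b%:R.
Proof. by case: b; [right|left]. Qed.

Lemma sum_pred1 (i0 : 'I_m) : \sum_i ((i0 == i)%:R : int) = 1.
Proof.
rewrite (bigD1 i0) //= eqxx big1 ?addr0 // => i /negPf.
by rewrite eq_sym => ->.
Qed.

Lemma layout_feasible sigma : lp_feasible A (layout_assignment sigma).
Proof.
split=> /=.
- by split=> *; apply: binaryb.
- split=> [i|j]; first exact: sum_pred1.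
  rewrite -[RHS](sum_pred1 (sigma^-1%g j)); apply: eq_bigr => i _.
  by rewrite /= (can2_eq (permK sigma) (permKV sigma)) eq_sym.
- move=> c /=; have cm : (c.+1 < m)%N by case: m c => [|n] [].
  pose J := [set j : 'I_m.-1 | pos_of j \in sigma @: cut A sigma c.+1].
  apply: (@le_trans _ _ (#|J|)%:Z).
    rewrite -sum1_card -natz natr_sum [leLHS]big_mkcond [leRHS]big_mkcond.
    by apply: ler_sum => j _; rewrite inE; case: ifP; case: ifP.
  rewrite lez_nat (leq_trans _ (cut_separation A sigma cm)) //.
  rewrite -(card_imset _ (@perm_inj _ sigma)) -(card_imset _ (@pos_of_inj m)).
  by apply/subset_leq_card/subsetP=> j /imsetP[j' + ->]; rewrite inE.
- by move=> i i' j j' /=; case: (_ == _); case: (_ == _).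
split=> [j c j' i i' jc cj' Aii'|j c jc] /=.
  case: eqP => //= sij; last by case: (_ \in _).
  case: eqP => //= sij'; last by case: (_ \in _).
  rewrite (_ : _ \in _) // -sij imset_f // inE sij ltnS jc.
  by apply/existsP; exists i'; rewrite sij' cj'.
have term_ge0 j' : 0 <= \sum_(i < m) \sum_(i' < m | A i' i)
    (((sigma i == pos_of j) && (sigma i' == j'))%:R : int).
  by do 2 apply: sumr_ge0 => ? _.
(* If [lp_Y] is 1, a cut member [i] and a late in-neighbour [i'] give one summand equal to 1; the
   others are non-negative. *)
rewrite subr_ge0; case: imsetP => [[i]|_]; last by apply: sumr_ge0.
rewrite inE => /andP[ic /existsP[i' /andP[ci' Aii']]] E.
rewrite (bigD1 (sigma i')) //= (bigD1 i) //= (bigD1 i') //= E !eqxx /=.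
rewrite -!addrA lerDl !addr_ge0 //; try by do ?apply: sumr_ge0 => ? _.
Qed.

(* For [m <= 1] the objective is unbounded below. *)
Lemma optimal_gt1 s : lp_optimal A s -> (1 < m)%N.
Proof.
case=> -[dom c1 c2 c3 c4] opt; rewrite ltnNge; apply/negP=> m1.
pose s' := LpAssignment (lp_x s) (lp_w s - 1) (lp_X s) (lp_Y s).
have: lp_feasible A s'.
  split; [exact: dom | exact: c1 | | exact: c3 | exact: c4].
  by rewrite /lp_constr2 /= => -[c cm]; lia.
by move/opt => /=; lia.
Qed.

End LinearProgram.

Theorem theorem7 (T B : eqType) (plt : B -> T) (k : nat)
    (Q : k.-tuple (seq B)) (hQ : instance plt Q)
    (m : nat) (v : m.-tuple T) (hv : perm_eq v (pallets plt Q)) :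
  let A : rel 'I_m := fun i i' => seq_arc plt Q (tnth v i) (tnth v i') in
  (forall s : lp_assignment m, lp_optimal A s ->
     exists2 p : nat, p%:Z = lp_w s + 1 & min_processable plt Q p) /\
  ((1 < m)%N -> exists s : lp_assignment m, lp_optimal A s).
Proof.
move=> A; split=> [s opt_s|m1].
  have m1 := optimal_gt1 opt_s; case: opt_s => feas opt.
  have [sigma le_w] := feasible_separation m1 feas.
  have w_le tau : lp_w s <= (separation A tau)%:Z.
    exact: opt (layout_feasible A tau).
  (* Optimality against the layout assignments gives the reverse inequality, so [sigma] has least
     separation. *)
  have wE : lp_w s = (separation A sigma)%:Z by apply/le_anti; rewrite w_le.
  exists (separation A sigma).+1; first by rewrite wE; lia.
  split=> [|p' /(separation_processable hv hQ (ltnW m1))[tau]].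
    exact: processable_separation.
  by apply: leq_ltn_trans; rewrite -lez_nat -wE.
(* There are finitely many layouts, so one of least separation exists, and its assignment is
   optimal. *)
case: (arg_minnP (separation A) (isT : predT (1%g : 'S_m))) => sigma _ sigma_min.
exists (layout_assignment A sigma); split=> [|s' feas]; first exact: layout_feasible.
have [tau le_w] := feasible_separation m1 feas.
by apply: le_trans le_w; rewrite lez_nat sigma_min.
Qed.
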